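(* Let $(X,\tau)$ be an uncountable Polish space and $1\le\xi<\omega_1$. If $f:X\to\mathbb{R}$ is a Baire class $\xi$ function and $F\subseteq X$ is closed, then $f\cdot\chi_F$ is of Baire class $\xi$, and $\alpha^*_\xi(f\cdot\chi_F)\le 1+\alpha^*_\xi(f)$, $\beta^*_\xi(f\cdot\chi_F)\le1+\beta^*_\xi(f)$ and $\gamma^*_\xi(f\cdot\chi_F)\le1+\gamma^*_\xi(f)$.
   Context: For a Baire class $\xi$ function $f$, let $T_{f,\xi}$ be the set of Polish topologies $\tau'\supseteq\tau$ on $X$ with $\tau'\subseteq\boldsymbol\Sigma^0_\xi(\tau)$ such that $f$ is Baire class $1$ with respect to $\tau'$. For a rank $\rho$ on Baire class $1$ functions, $\rho^*_\xi(f)=\min_{\tau'\in T_{f,\xi}}\rho_{\tau'}(f)$, where $\rho_{\tau'}$ is $\rho$ computed in topology $\tau'$. Base ranks (in a topology on $X$): derivatives are monotone maps $D$ on closed sets with $D(F)\subseteq F$; iterates $D^{\eta+1}=D\circ D^\eta$, intersections at limits; $\mathrm{rk}(D)$ = least $\eta$ with $D^\eta(X)=\emptyset$. $\alpha(f)=\sup_{p<q\in\mathbb{Q}}\mathrm{rk}(D_{A,B})$, $A=\{f\le p\}$, $B=\{f\ge q\}$, $D_{A,B}(F)=\overline{F\cap A}\cap\overline{F\cap B}$. $\beta(f)=\sup_{\varepsilon>0}\mathrm{rk}(D_{f,\varepsilon})$, $D_{f,\varepsilon}(F)=\{x\in F:\inf_{U\ni x\text{ open}}\sup_{x_1,x_2\in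 U\cap F}|f(x_1)-f(x_2)|\ge\varepsilon\}$. $\gamma(f)=\min\{\sup_{\varepsilon>0}\mathrm{rk}(D_{(f_n),\varepsilon}): f_n\text{ continuous}, f_n\to f\text{ pointwise}\}$, $D_{(f_n),\varepsilon}(F)=\{x\in F:\inf_{U\ni x\text{ open}}\inf_N\sup\{|f_m(y)-f_n(y)|:n,m\ge N,y\in U\cap F\}\ge\varepsilon\}$. *)

(* Defs.v *)
From HB Require Import structures.
From mathcomp Require Import all_boot all_order all_algebra.
From mathcomp Require Import all_classical all_reals all_analysis.
Set Implicit Arguments.
Unset Strict Implicit.
Unset Printing Implicit Defensive.
Import Order.TTheory GRing.Theory Num.Theory.
Import numFieldNormedType.Exports.
Local Open Scope classical_set_scope.
Local Open Scope ring_scope.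

(* A term of type Ord is a notation for an ordinal, built from 0, successor and
   suprema of arbitrary families.  Distinct terms may denote the same ordinal,
   so ordinals are compared with the preorder ole, never with Leibniz equality. *)
Inductive Ord : Type :=
| ozero : Ord
| osucc : Ord -> Ord
| osup : forall I : Type, (I -> Ord) -> Ord.

(* a + 1 <= b means a < b, and a < b is decided by recursion on b:
   a < b' + 1 iff a <= b', and a < sup_i b_i iff a < b_i for some i. *)
Fixpoint ole (a : Ord) : Ord -> Prop :=
  match a with
  | ozero => fun _ => True
  | osucc a' =>
      fix lt_a' (b : Ord) : Prop :=
        match b with
        | ozero => False
        | osucc b' => ole a' b'
        | osup J g => exists i : J, lt_a' (g i)
        end
  | osup J f => fun b => forall i : J, ole (f i) b
  end.

Definition olt (a b : Ord) : Prop := ole (osucc a) b.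

Definition oone : Ord := osucc ozero.

(* The first summand is a member of the family in the limit case so that
   a + sup of the empty family is a. *)
Fixpoint oadd (a b : Ord) : Ord :=
  match b with
  | ozero => a
  | osucc b' => osucc (oadd a b')
  | osup J g => osup (fun i : option J =>
                        if i is Some j then oadd a (g j) else a)
  end.

(* Using suprema of sequences only, one reaches exactly the countable ordinals. *)
Inductive countable_ord : Set :=
| czero : countable_ord
| csucc : countable_ord -> countable_ord
| csup : (nat -> countable_ord) -> countable_ord.

Fixpoint ord_of_countable (c : countable_ord) : Ord :=
  match c with
  | czero => ozero
  | csucc c' => osucc (ord_of_countable c')
  | csup g => osup (fun n => ord_of_countable (g n))
  end.

Definition omega1 : Ord := osup ord_of_countable.

Definition is_omin (S : set Ord) (a : Ord) : Prop :=
  S a /\ forall b, S b -> ole a b.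

(* Least element of S; by convention omega1 if S is empty.  In particular the
   rank of a derivative with no empty iterate is omega1. *)
Definition omin (S : set Ord) : Ord :=
  match pselect (exists a, is_omin S a) with
  | left ex_min => projT1 (cid ex_min)
  | right _ => omega1
  end.

Definition polish (R : realType) (Y : topologicalType) : Prop :=
  exists (M : metricType R) (h : M -> Y) (k : Y -> M),
    [/\ cancel h k, cancel k h, continuous h & continuous k] /\
    (forall F : set_system M, ProperFilter F -> cauchy F -> exists l : M, F --> l) /\
    (exists D : set M, countable D /\ dense D).

Record topology_on (X : Type) := TopologyOn {
  topo_open : set (set X);
  topo_openT : topo_open setT;
  topo_openI : forall U V, topo_open U -> topo_open V -> topo_open (U `&` V);
  topo_open_bigcup : forall S : set (set X),
    S `<=` topo_open -> topo_open (\bigcup_(U in S) U) }.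

(* The set X with its own topology replaced by t. *)
Definition retop (X : choiceType) (t : topology_on X) : Type := X.

Section RetopTopological.
Variables (X : choiceType) (t : topology_on X).

Lemma retop_bigcup (I : Type) (f : I -> set X) :
  (forall i, topo_open t (f i)) -> topo_open t (\bigcup_i f i).
Proof.
move=> tf; suff -> : \bigcup_i f i = \bigcup_(U in range f) U.
  by apply: topo_open_bigcup => _ [i _ <-].
by rewrite bigcup_image.
Qed.

HB.instance Definition _ := Choice.on (retop t).
HB.instance Definition _ := @isOpenTopological.Build (retop t)
  (topo_open t) (topo_openT t) (@topo_openI _ t) retop_bigcup.
End RetopTopological.

(* Sanity check: the open sets of retop t are those of t. *)
Lemma open_retop (X : choiceType) (t : topology_on X) (U : set X) :
  @open (retop t) U = topo_open t U.
Proof. by []. Qed.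

Inductive Sigma0 (Y : topologicalType) : Ord -> set Y -> Prop :=
| Sigma0_open xi (U : set Y) :
    ole xi oone -> ole oone xi -> open U -> Sigma0 xi U
| Sigma0_bigcup xi (A : nat -> set Y) (xi_ : nat -> Ord) :
    (forall n, ole oone (xi_ n)) -> (forall n, olt (xi_ n) xi) ->
    (forall n, Sigma0 (xi_ n) (~` A n)) ->
    Sigma0 xi (\bigcup_n A n).

Inductive BaireClass (R : realType) (Y : topologicalType) : Ord -> (Y -> R) -> Prop :=
| BaireClass_continuous xi (f : Y -> R) :
    ole xi ozero -> continuous f -> BaireClass xi f
| BaireClass_limit xi (f : Y -> R) (f_ : nat -> Y -> R) (xi_ : nat -> Ord) :
    (forall n, olt (xi_ n) xi) -> (forall n, BaireClass (xi_ n) (f_ n)) ->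
    (forall x, f_ ^~ x @ \oo --> f x) ->
    BaireClass xi f.

Section Rank.
Variable Y : Type.

Fixpoint diter (D : set Y -> set Y) (eta : Ord) : set Y :=
  match eta with
  | ozero => setT
  | osucc eta' => D (diter D eta')
  | osup J g => \bigcap_i diter D (g i)
  end.

Definition rk (D : set Y -> set Y) : Ord :=
  omin [set eta | diter D eta = set0].
End Rank.

Section BaseRanks.
Variables (R : realType) (Y : topologicalType).
Implicit Types (f : Y -> R) (F : set Y) (e : R).

Definition Dsep (A B F : set Y) : set Y :=
  closure (F `&` A) `&` closure (F `&` B).

Definition alpha_rank f : Ord :=
  osup (fun pq : {pq : rat * rat | pq.1 < pq.2} =>
    rk (Dsep [set x | f x <= ratr (sval pq).1]
             [set x | ratr (sval pq).2 <= f x])).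

(* Infima and suprema below are taken in the extended reals. *)
Definition oscillation f F (x : Y) : \bar R :=
  ereal_inf [set ereal_sup [set (`|f z.1 - f z.2|)%:E
                           | z in (U `&` F) `*` (U `&` F)]
            | U in [set U : set Y | open U /\ U x]].

Definition Dosc f e F : set Y :=
  [set x | F x /\ (e%:E <= oscillation f F x)%E].

Definition beta_rank f : Ord :=
  osup (fun e : {e : R | 0 < e} => rk (Dosc f (sval e))).

Definition conv_oscillation (f_ : nat -> Y -> R) F (x : Y) : \bar R :=
  ereal_inf [set ereal_inf [set
      ereal_sup [set v | exists n m y, [/\ (N <= n)%N, (N <= m)%N,
                           (U `&` F) y & v = (`|f_ m y - f_ n y|)%:E]]
      | N in [set: nat]]
    | U in [set U : set Y | open U /\ U x]].

Definition Dconv (f_ : nat -> Y -> R) e F : set Y :=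
  [set x | F x /\ (e%:E <= conv_oscillation f_ F x)%E].

Definition gamma_rank f : Ord :=
  omin [set r | exists f_ : nat -> Y -> R,
    [/\ forall n, continuous (f_ n),
        forall x, f_ ^~ x @ \oo --> f x &
        r = osup (fun e : {e : R | 0 < e} => rk (Dconv f_ (sval e)))]].
End BaseRanks.

Section StarRanks.
Variables (R : realType) (X : topologicalType).

Definition Tset (f : X -> R) (xi : Ord) : set (topology_on X) :=
  [set t | [/\ polish R (retop t),
               @open X `<=` topo_open t,
               topo_open t `<=` Sigma0 xi &
               @BaireClass R (retop t) oone f]].

Definition star (rho : forall Y : topologicalType, (Y -> R) -> Ord)
    (xi : Ord) (f : X -> R) : Ord :=
  omin [set r | exists2 t, Tset f xi t & r = rho (retop t) f].
End StarRanks.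

(* Main.v *)
(* A closed set F of X is closed in every finer topology, so each topology
   admissible for f is admissible for f * 1_F, and it suffices to compare the base
   ranks in one Polish topology.  There the first derivative of f * 1_F is
   contained in F, because f * 1_F vanishes off F; on subsets of F both
   functions have the same derivative, so the (1 + eta)-th derivative of
   f * 1_F is contained in the eta-th derivative of f.  For gamma, an
   approximating sequence of f is multiplied by continuous cutoffs equal to 1
   on F that vanish eventually near each point off F. *)
Require Import Defs.
From mathcomp Require Import all_boot all_order all_algebra.
From mathcomp Require Import all_classical all_reals all_analysis.
From mathcomp Require Import ring.
Set Implicit Arguments.
Unset Strict Implicit.
Unset Printing Implicit Defensive.
Import Order.TTheory GRing.Theory Num.Theory.
Import numFieldNormedType.Exports.
Local Open Scope classical_set_scope.
Local Open Scope ring_scope.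

(** * Order, least elements and addition of ordinal notations *)

Lemma ole_osup (a : Ord) (I : Type) (g : I -> Ord) (i : I) :
  ole a (g i) -> ole a (osup g).
Proof.
elim: a => [//|a _|J h IH] /= ag; first by exists i.
by move=> j; exact: IH.
Qed.

Lemma olexx (a : Ord) : ole a a.
Proof. by elim: a => // I g IH /= i; apply: (@ole_osup _ _ _ i). Qed.

(** When [a] is a successor, [ole] recurses on its right argument, so inductions on [b] and then on
    [c] are nested inside the one on [a]. *)
Lemma ole_trans (b a c : Ord) : ole a b -> ole b c -> ole a c.
Proof.
elim: a b c => [//|a IHa|I f IHf] b c.
  elim: b c => [//|b _|J g IHg] c.
    move=> /= ab; elim: c => [//|c _|K h IHh] /=; first exact: IHa.
    by move=> [k bk]; exists k; exact: IHh.
  by move=> [j agj] gc; apply: (IHg j).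
by move=> fb bc i; apply: (IHf i) (fb i) bc.
Qed.

Lemma ole_osucc (a : Ord) : ole a (osucc a).
Proof.
elim: a => [//|//|I g IH] /= i.
by apply: (ole_trans (IH i)); apply: (@ole_osup _ _ g i); exact: olexx.
Qed.

(* The two halves are proved together: the successor step of each uses the
   other one. *)
Lemma ole_or_olt (a b : Ord) :
  (ole a b \/ olt b a) /\ (ole b a \/ olt a b).
Proof.
elim: a b => [|a IHa|I f IHf] b.
- split; first by left.
  elim: b => [|b _|J g IHg]; [by left|by right|].
  have [[j lt0]|nlt] := pselect (exists j, olt ozero (g j)).
    by right; exists j.
  by left => j; have [//|lt0] := IHg j; case: nlt; exists j.
- split; first by have [_ [|]] := IHa b; [right|left].
  elim: b => [|b _|J g IHg]; first by left.
    by have [_ [|]] := IHa b; [left|right].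
  have [[j ltj]|nlt] := pselect (exists j, olt (osucc a) (g j)).
    by right; exists j.
  by left => j; have [//|ltj] := IHg j; case: nlt; exists j.
- split.
    have [[i lti]|nlt] := pselect (exists i, olt b (f i)).
      by right; exists i.
    by left => i; have [[//|lti] _] := IHf i b; case: nlt; exists i.
  elim: b => [|b _|J g IHg]; first by left.
    have [[i lti]|nlt] := pselect (exists i, olt b (f i)).
      by left; exists i.
    by right => i; have [[//|lti] _] := IHf i b; case: nlt; exists i.
  have [[j ltj]|nlt] := pselect (exists j, olt (osup f) (g j)).
    by right; exists j.
  by left => j; have [//|ltj] := IHg j; case: nlt; exists j.
Qed.

(** The induction is on an upper bound [a] of a member [b]: either some member lies below a smaller
    bound, or totality puts every member above [a], which makes [b] least. *)
Lemma ex_omin (S : set Ord) : S !=set0 -> exists a, is_omin S a.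
Proof.
move=> [a0 Sa0].
suff H : forall a b, ole b a -> S b -> exists m, is_omin S m.
  exact: (H a0 a0 (olexx a0) Sa0).
elim=> [|a IHa|I g IHg] b ba Sb.
- by exists b; split=> // c _; exact: ole_trans ba _.
- have [[c [ca Sc]]|nS] := pselect (exists c, ole c a /\ S c).
    exact: IHa ca Sc.
  exists b; split=> // c Sc; apply: ole_trans ba _.
  by have [_ [ca|//]] := ole_or_olt a c; case: nS; exists c.
- have [[c [i [ci Sc]]]|nS] := pselect (exists c i, ole c (g i) /\ S c).
    exact: IHg ci Sc.
  exists b; split=> // c Sc; apply: ole_trans ba _ => i.
  have [_ [ci|gc]] := ole_or_olt (g i) c; first by case: nS; exists c, i.
  exact: ole_trans (ole_osucc _) gc.
Qed.

Lemma omin_mem (S : set Ord) : S !=set0 -> S (omin S).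
Proof.
move=> /ex_omin exS; rewrite /omin; case: pselect => // ex.
by case: (projT2 (cid ex)).
Qed.

Lemma omin_le (S : set Ord) (a : Ord) : S a -> ole (omin S) a.
Proof.
move=> Sa; rewrite /omin; case: pselect => [ex|[]].
  by case: (projT2 (cid ex)) => _; apply.
by apply: ex_omin; exists a.
Qed.

Lemma ominNex (S : set Ord) : ~ (S !=set0) -> omin S = omega1.
Proof.
move=> nS; rewrite /omin; case: pselect => // ex.
by case: nS; case: ex => a [Sa _]; exists a.
Qed.

Lemma oadd_ler (a b : Ord) : ole b (oadd a b).
Proof.
elim: b => [//|//|J g IH] /= j.
exact: (@ole_osup _ _ _ (Some j)).
Qed.

Lemma oadd_lel (a b : Ord) : ole a (oadd a b).
Proof.
elim: b => [|b IH|J g IH] /=; first exact: olexx.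
  exact: ole_trans IH (ole_osucc _).
by apply: (@ole_osup _ _ _ None); exact: olexx.
Qed.

Lemma oadd_le2l (a b c : Ord) : ole b c -> ole (oadd a b) (oadd a c).
Proof.
elim: b c => [|b IH|J g IH] c /=; first by move=> _; exact: oadd_lel.
  elim: c => [//|c _|K h IHh] /=; first exact: IH.
  by move=> [k bk]; exists (Some k); exact: IHh.
move=> gc [j|]; last exact: oadd_lel.
exact: IH (gc j).
Qed.

(** * Comparison of the ranks of two derivatives *)

(** One step of [D'] leads into [C], where [D'] is dominated by [D]; this step is the added 1 on the
    left. The bound by [omega1] serves the case where [D] has no empty iterate. *)
Lemma rk_shift (Y : Type) (D D' : set Y -> set Y) (C : set Y) :
  {homo D : H K / H `<=` K} -> {homo D' : H K / H `<=` K} ->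
  D' setT `<=` C -> (forall H, H `<=` C -> D' H `<=` D H) ->
  ole (rk D') omega1 -> ole (rk D') (oadd oone (rk D)).
Proof.
move=> Dh D'h D'C D'D rk1.
have [ex|nex] := pselect ([set eta | diter D eta = set0] !=set0); last first.
  rewrite [rk D](ominNex nex).
  exact: ole_trans rk1 (oadd_ler _ _).
have sub eta : diter D' (oadd oone eta) `<=` C `&` diter D eta.
  elim: eta => [|eta IH|J g IH] /=.
  - by move=> x /D'C.
  - move=> x D'x; split; first by apply: D'C; exact: D'h _ _ _ _ D'x.
    have /D'D : diter D' (oadd oone eta) `<=` C by move=> y /IH[].
    by move=> /(_ x D'x); apply: Dh => y /IH[].
  (* The index [None] of the limit sum is stage 1, so the iterate stays in [C] even for an empty
     family. *)
  - move=> x D'x; split; first by apply: D'C; exact: (D'x None I).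
    by move=> j _; have /IH[] := D'x (Some j) I.
apply: omin_le => /=; rewrite -subset0 => x /sub[_].
by rewrite (omin_mem ex).
Qed.

(** * Polish spaces: countable separation, cutoff functions, countable stationarity *)

(** The sets are the balls of radius [1 / (m + 1)] around points of a countable dense set, indexed
    by codes of centre and [m]; an [n] that is no code gives the empty set. *)
Lemma polish_countable_sep (R : realType) (Y : topologicalType) :
  polish R Y -> exists U : nat -> set Y,
    forall (C : set Y) x, closed C -> ~ C x ->
      exists n, U n x /\ U n `&` C = set0.
Proof.
move=> [M [h [k [[hk kh hc kc] [_ [S [/countable_injP[c c_inj] dS]]]]]]].
pose U n := [set y | exists d m,
  [/\ S d, n = pickle (c d, m) & ball d m.+1%:R^-1 (k y)]].
exists U => C x closedC nCx.
have oO : open (h @^-1` (~` C)).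
  by apply: open_comp; [move=> y _; exact: hc|exact: closed_openC].
have /nbhs_ballP[e /= e0 eO] : nbhs (k x) (h @^-1` (~` C)).
  by apply: open_nbhs_nbhs; split=> //; rewrite /= kh.
(* With [2 / (m + 1) <= e], a ball of radius [1 / (m + 1)] containing [k x] lies in the [e]-ball
   around [k x]. *)
pose m := Num.truncn (2 / e).
have m0 : 0 < m.+1%:R^-1 :> R by rewrite invr_gt0 ltr0n.
have mm_e : m.+1%:R^-1 + m.+1%:R^-1 <= e.
  rewrite -mulr2n -[leLHS]mulr_natl ler_pdivrMr ?ltr0n// -ler_pdivrMl// mulrC.
  by apply: ltW; exact: truncnS_gt.
have [d [/interior_subset bd Sd]] : (ball (k x) m.+1%:R^-1)^° `&` S !=set0.
  apply: dS; last exact: open_interior.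
  by exists (k x); exact: nbhsx_ballx.
exists (pickle (c d, m)); split; first by exists d, m; split=> //; exact: ball_sym.
rewrite -subset0 => y [[d' [m' [Sd' /(pcan_inj pickleK)[cdd' mm'] bd']]] Cy].
have dd' : d = d' by apply: c_inj; rewrite ?inE.
rewrite -dd' -mm' in bd'.
apply: (eO (k y)); last by rewrite kh.
by apply: le_ball mm_e _ _; exact: ball_triangle bd bd'.
Qed.

(** The cutoffs are [max(0, 1 - n d)], where [d] is the distance to [F] in a compatible metric. *)
Lemma polish_cutoff (R : realType) (Y : topologicalType) (F : set Y) :
  polish R Y -> closed F -> exists u : nat -> Y -> R,
    [/\ forall n, continuous (u n), forall n x, F x -> u n x = 1 &
        forall x, ~ F x -> exists U N, [/\ open U, U x &
          forall n y, (N <= n)%N -> U y -> u n y = 0] ].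
Proof.
move=> [M [h [k [[hk kh hc kc] _]]]] closedF.
(* The distance to the empty set is infinite, so this case takes zero cutoffs. *)
have [->|/set0P[y0 Fy0]] := eqVneq F set0.
  exists (fun _ _ => 0); split=> // [n x|x _]; first exact: cvg_cst.
  by exists setT, 0%N; split=> //; exact: openT.
pose A : set M := h @^-1` F.
have closedA : closed A by apply: closed_comp => // x _; exact: hc.
have Ay0 : A (k y0) by rewrite /A /= kh.
have mdist_fin (x y : M) : edist (x, y) \is a fin_num.
  apply/edist_finP; exists (mdist x y + 1).
    by rewrite ltr_wpDl// mdist_ge0.
  by rewrite ballEmdist/= ltrDl.
have dfin x : edist_inf A x \is a fin_num.
  rewrite ge0_fin_numE ?edist_inf_ge0 //.
  apply: (@le_lt_trans _ _ (edist (x, k y0))).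
    by apply: ereal_inf_lbound; exists (k y0).
  by rewrite -ge0_fin_numE ?edist_ge0.
pose d x := fine (edist_inf A x).
have d_ge0 x : 0 <= d x by rewrite fine_ge0 ?edist_inf_ge0.
have dc : continuous d.
  move=> x; apply: fine_cvg; rewrite fineK//; exact: edist_inf_continuous.
have dtri x y : d x <= fine (edist (x, y)) + d y.
  rewrite -lee_fin EFinD !fineK//; exact: edist_inf_triangle.
exists (fun n y => Num.max 0 (1 - n%:R * d (k y))); split.
- move=> n y; apply: (@continuous_max _ _ (fun=> 0) (fun y => 1 - n%:R * d (k y))).
    exact: cvg_cst.
  apply: cvgB; first exact: cvg_cst.
  apply: cvgM; first exact: cvg_cst.
  by apply: continuous_comp; [exact: kc|exact: dc].
- move=> n x Fx; rewrite /d edist_inf0/=; last by rewrite /A /= kh.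
  by rewrite mulr0 subr0 max_r.
- move=> x nFx.
  have nAx : (~` A) (k x) by rewrite /A /= kh.
  have /nbhs_ballP[e /= e0 eA] : nbhs (k x) (~` A).
    by apply: open_nbhs_nbhs; split=> //; exact: closed_openC.
  have e_le : e <= d (k x).
    rewrite -lee_fin fineK//; apply: le_ereal_inf_tmp => _ [a Aa <-].
    rewrite leNgt; apply/negP => /(@edist_lt_ball _ _ e (k x, a))/= /eA.
    by apply.
  have e20 : 0 < e / 2 by rewrite divr_gt0.
  (* On this neighbourhood [n d >= 1] as soon as [n >= 2 / e]. *)
  exists ((d \o k) @^-1` [set r | e / 2 < r]), (Num.truncn (2 / e)).+1; split.
  + apply: open_comp; last exact: open_gt.
    by move=> y _; apply: continuous_comp; [exact: kc|exact: dc].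
  + rewrite /=; apply: lt_le_trans e_le.
    by rewrite ltr_pdivrMr// ltr_pMr// ltr1n.
  + move=> n y nN /= ey; apply: max_l; rewrite subr_le0.
    have n2 : 2 / e <= n%:R.
      apply: (@le_trans _ _ (Num.truncn (2 / e)).+1%:R); last by rewrite ler_nat.
      by apply: ltW; exact: truncnS_gt.
    have e1 : (2 / e) * (e / 2) = 1 by field; rewrite gt_eqF.
    rewrite -[leLHS]e1.
    apply: ler_pM n2 (ltW ey); first by rewrite divr_ge0 ?ler0n ?ltW.
    exact: ltW.
Qed.

(* Cantor-Baire stationarity: with U a countable separating family, the iterate at
   the supremum of the first countable stages at which each U n is emptied is
   contained in all iterates.  Needed because rk D = omega1 by convention when
   no iterate is empty. *)
Lemma rk_le_omega1 (R : realType) (Y : topologicalType) (D : set Y -> set Y) :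
  polish R Y -> {homo D : H K / H `<=` K} ->
  (forall H, closed H -> closed (D H)) -> ole (rk D) omega1.
Proof.
move=> /polish_countable_sep[U sepU] Dh Dc.
have [[eta Deta]|nex] := pselect ([set eta | diter D eta = set0] !=set0);
  last by rewrite /rk (ominNex nex); exact: olexx.
have citer zeta : closed (diter D zeta).
  elim: zeta => [|zeta IH|J g IH] /=; [exact: closedT|exact: Dc|].
  exact: closed_bigI => j _.
(* [c n] is a countable stage that empties [U n] if there is one, and arbitrary otherwise. *)
have /choice[c cP] n : exists c, (exists c',
    U n `&` diter D (ord_of_countable c') = set0) ->
    U n `&` diter D (ord_of_countable c) = set0.
  have [[c' c'P]|nc] := pselect (exists c',
    U n `&` diter D (ord_of_countable c') = set0); first by exists c'.
  by exists Defs.czero => /nc.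
pose K := diter D (ord_of_countable (csup c)).
(* A point of [K] outside [D K] has some [U n] around it that misses [D K], the iterate at a
   countable stage; then stage [c n] already empties [U n], yet its iterate contains [K]. *)
have KD : K `<=` D K.
  move=> x Kx; apply: contrapT => nDKx.
  have [n [Unx Un0]] := sepU _ x (Dc _ (citer _)) nDKx.
  have /cP/seteqP[+ _] : exists c',
      U n `&` diter D (ord_of_countable c') = set0 by exists (csucc (csup c)).
  by apply; split; [exact: Unx|exact: Kx n I].
have Ksub zeta : K `<=` diter D zeta.
  elim: zeta => [//|zeta IH|J g IH] /=; first exact: subset_trans KD (Dh _ _ IH).
  by move=> x Kx j _; exact: IH.
apply: (@ole_trans (ord_of_countable (csup c))).
  by apply: omin_le => /=; rewrite -/K -subset0 -Deta; exact: Ksub.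
exact: (@ole_osup _ _ ord_of_countable (csup c) (olexx _)).
Qed.

(** * Monotonicity, closedness and locality of the concrete derivatives *)

Lemma Dsep_homo (Y : topologicalType) (A B : set Y) :
  {homo Dsep A B : H K / H `<=` K}.
Proof.
by move=> H K HK x [xA xB]; split; [move: xA|move: xB];
  apply: closure_subset; exact: setSI.
Qed.

Lemma closed_Dsep (Y : topologicalType) (A B H : set Y) : closed (Dsep A B H).
Proof. by apply: closedI; exact: closed_closure. Qed.


(* Common form of Dosc and Dconv: s measures the variation on a set. *)
Definition Dloc (R : realType) (Y : topologicalType) (s : set Y -> \bar R)
    (e : R) (H : set Y) : set Y :=
  [set x | H x /\ (e%:E <= ereal_inf [set s (U `&` H)
                                     | U in [set U | open U /\ U x]])%E].

Lemma Dloc_homo (R : realType) (Y : topologicalType) (s : set Y -> \bar R)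
    (e : R) :
  {homo s : V W / V `<=` W >-> (V <= W)%E} ->
  {homo Dloc s e : H K / H `<=` K}.
Proof.
move=> sh H K HK x [Hx eH]; split; first exact: HK.
apply: (le_trans eH); apply: le_ereal_inf_tmp => _ [U Ux <-].
apply: (@le_trans _ _ (s (U `&` H))); last by apply: sh; exact: setIS.
by apply: ereal_inf_lbound; exists U.
Qed.

(** An open neighbourhood of a limit point is also a neighbourhood of a point of the derivative,
    whose lower bound therefore applies to it. *)
Lemma closed_Dloc (R : realType) (Y : topologicalType) (s : set Y -> \bar R)
    (e : R) (H : set Y) : closed H -> closed (Dloc s e H).
Proof.
move=> cH x clx; split.
  by apply: cH => V /clx[y [[Hy _] Vy]]; exists y.
apply: le_ereal_inf_tmp => _ [U [oU Ux] <-].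
have [y [[_ +] Uy]] := clx U (open_nbhs_nbhs (conj oU Ux)).
by move=> /le_trans; apply; apply: ereal_inf_lbound; exists U.
Qed.

Lemma Dloc_setT_sub (R : realType) (Y : topologicalType)
    (s : set Y -> \bar R) (e : R) (C : set Y) :
  (forall x, ~ C x -> exists U, [/\ open U, U x & (s U < e%:E)%E]) ->
  Dloc s e setT `<=` C.
Proof.
move=> sC x [_ ex]; apply: contrapT => /sC[U [oU Ux]].
rewrite ltNge => /negP; apply; apply: (le_trans ex).
by apply: ereal_inf_lbound; exists U => //; rewrite setIT.
Qed.

Lemma Dloc_eq_in (R : realType) (Y : topologicalType)
    (s s' : set Y -> \bar R) (e : R) (C H : set Y) :
  (forall W, W `<=` C -> s' W = s W) -> H `<=` C -> Dloc s' e H `<=` Dloc s e H.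
Proof.
move=> ss' HC x [Hx ex]; split=> //; apply: (le_trans ex).
apply: le_ereal_inf_tmp => _ [U Ux <-]; rewrite -ss'.
  by apply: ereal_inf_lbound; exists U.
by apply: subset_trans HC; exact: subIsetr.
Qed.

Definition diam (R : realType) (Y : Type) (f : Y -> R) (W : set Y) : \bar R :=
  ereal_sup [set (`|f z.1 - f z.2|)%:E | z in W `*` W].

Lemma Dosc_Dloc (R : realType) (Y : topologicalType) (f : Y -> R) (e : R) :
  Dosc f e = Dloc (diam f) e.
Proof. by []. Qed.

Lemma diam_homo (R : realType) (Y : Type) (f : Y -> R) :
  {homo diam f : V W / V `<=` W >-> (V <= W)%E}.
Proof.
move=> V W VW; apply: ereal_sup_le => _ [z [Vz1 Vz2] <-]; exists z => //.
by split; exact: VW.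
Qed.

(** On a nonempty set this vanishes exactly when the sequence is uniformly Cauchy there. *)
Definition cauchy_diam (R : realType) (Y : Type) (f_ : nat -> Y -> R)
    (W : set Y) : \bar R :=
  ereal_inf [set ereal_sup [set v | exists n m y, [/\ (N <= n)%N, (N <= m)%N,
                              W y & v = (`|f_ m y - f_ n y|)%:E]]
            | N in [set: nat]].

Lemma Dconv_Dloc (R : realType) (Y : topologicalType) (f_ : nat -> Y -> R)
  (e : R) : Dconv f_ e = Dloc (cauchy_diam f_) e.
Proof. by []. Qed.

Lemma cauchy_diam_homo (R : realType) (Y : Type) (f_ : nat -> Y -> R) :
  {homo cauchy_diam f_ : V W / V `<=` W >-> (V <= W)%E}.
Proof.
move=> V W VW; apply: le_ereal_inf_tmp => _ [N _ <-].
apply: (@le_trans _ _ (ereal_sup [set v | exists n m y, [/\ (N <= n)%N,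
    (N <= m)%N, V y & v = (`|f_ m y - f_ n y|)%:E]])).
  by apply: ereal_inf_lbound; exists N.
apply: ereal_sup_le => _ [n [m [y [Nn Nm Vy ->]]]].
by exists n, m, y; split=> //; exact: VW.
Qed.

(** * Bounds for ranks at a fixed parameter and for their suprema *)

Lemma osup_shift (I : Type) (a b : I -> Ord) :
  (forall i, ole (b i) (oadd oone (a i))) ->
  ole (osup b) (oadd oone (osup a)).
Proof.
move=> ba i; apply: ole_trans (ba i) _; apply: oadd_le2l.
exact: ole_osup (olexx (a i)).
Qed.

Lemma rk_Dsep_le (R : realType) (Y : topologicalType) (A B : set Y) :
  polish R Y -> ole (rk (Dsep A B)) omega1.
Proof.
move=> pY; apply: rk_le_omega1 pY _ _; first exact: Dsep_homo.
by move=> H _; exact: closed_Dsep.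
Qed.

Lemma rk_Dloc_le (R : realType) (Y : topologicalType) (s : set Y -> \bar R)
    (e : R) :
  polish R Y -> {homo s : V W / V `<=` W >-> (V <= W)%E} ->
  ole (rk (Dloc s e)) omega1.
Proof.
by move=> pY sh; apply: rk_le_omega1 pY _ _;
  [exact: Dloc_homo|exact: closed_Dloc].
Qed.

Lemma rk_Dloc_shift (R : realType) (Y : topologicalType)
    (s s' : set Y -> \bar R) (e : R) (C : set Y) :
  polish R Y ->
  {homo s : V W / V `<=` W >-> (V <= W)%E} ->
  {homo s' : V W / V `<=` W >-> (V <= W)%E} ->
  (forall W, W `<=` C -> s' W = s W) ->
  (forall x, ~ C x -> exists U, [/\ open U, U x & (s' U < e%:E)%E]) ->
  ole (rk (Dloc s' e)) (oadd oone (rk (Dloc s e))).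
Proof.
move=> pY sh s'h ss' s'C; apply: (@rk_shift _ _ _ C).
- exact: Dloc_homo.
- exact: Dloc_homo.
- exact: Dloc_setT_sub.
- by move=> H HC; exact: Dloc_eq_in ss' HC.
- exact: rk_Dloc_le.
Qed.

Lemma indicE1 (R : realType) (T : Type) (F : set T) (x : T) :
  F x -> \1_F x = 1 :> R.
Proof. by move=> Fx; rewrite indicE mem_set. Qed.

Lemma indicE0 (R : realType) (T : Type) (F : set T) (x : T) :
  ~ F x -> \1_F x = 0 :> R.
Proof. by move=> nFx; rewrite indicE memNset. Qed.

Lemma alpha_rank_le (R : realType) (Y : topologicalType) (f : Y -> R) :
  polish R Y -> ole (alpha_rank f) omega1.
Proof. by move=> pY pq; exact: rk_Dsep_le pY. Qed.

Lemma beta_rank_le (R : realType) (Y : topologicalType) (f : Y -> R) :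
  polish R Y -> ole (beta_rank f) omega1.
Proof.
move=> pY e; rewrite Dosc_Dloc; apply: rk_Dloc_le => //; exact: diam_homo.
Qed.

Lemma gamma_rank_le (R : realType) (Y : topologicalType) (f : Y -> R) :
  polish R Y -> ole (gamma_rank f) omega1.
Proof.
move=> pY; rewrite /gamma_rank; set S := [set r | _].
have [S0|nS] := pselect (S !=set0); last by rewrite (ominNex nS); exact: olexx.
have [f_ [_ _ ->]] := omin_mem S0 => e; rewrite Dconv_Dloc.
by apply: rk_Dloc_le => //; exact: cauchy_diam_homo.
Qed.

(** * Base ranks of the product with an indicator *)

Lemma alpha_rank_indic (R : realType) (Y : topologicalType) (f : Y -> R)
    (F : set Y) :
  polish R Y -> closed F ->
  ole (alpha_rank (fun x => f x * \1_F x)) (oadd oone (alpha_rank f)).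
Proof.
move=> pY cF; apply: osup_shift => -[[p q] /= pq].
have pqR : ratr p < ratr q :> R by rewrite ltr_rat.
apply: (@rk_shift _ _ _ F); [exact: Dsep_homo|exact: Dsep_homo| | |].
- have clF (A : set Y) : A `<=` F -> closure A `<=` F.
    by move=> AF; rewrite (closure_id F).1//; exact: closure_subset.
  rewrite /Dsep !setTI => x [xA xB].
  (* Since [p < q], the value 0 taken off [F] fails [<= p] or fails [>= q]; the corresponding level
     set, and with it its closure, lies in [F]. *)
  have [p0|p0] := ltP (ratr p) (0 : R).
    apply: clF xA => y /=; apply: contraPP => nFy.
    by rewrite indicE0// mulr0 => /le_lt_trans /(_ p0); rewrite ltxx.
  apply: clF xB => y /=; apply: contraPP => nFy; rewrite indicE0// mulr0.
  by apply/negP; rewrite -ltNge; exact: le_lt_trans p0 pqR.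
- move=> H HF x [xA xB]; split; [move: xA|move: xB];
    by apply: closure_subset => y [Hy /=]; rewrite (indicE1 _ (HF _ Hy)) mulr1.
- exact: rk_Dsep_le pY.
Qed.

Lemma beta_rank_indic (R : realType) (Y : topologicalType) (f : Y -> R)
    (F : set Y) :
  polish R Y -> closed F ->
  ole (beta_rank (fun x => f x * \1_F x)) (oadd oone (beta_rank f)).
Proof.
move=> pY cF; apply: osup_shift => -[e /= e0]; rewrite !Dosc_Dloc.
apply: (@rk_Dloc_shift _ _ _ _ _ F) => //; try exact: diam_homo.
- move=> W WF; congr ereal_sup; apply: eq_imagel => z [Wz1 Wz2].
  by rewrite !indicE1 ?mulr1//; exact: WF.
(* The product is constantly 0 on the open complement of [F]. *)
- move=> x nFx; exists (~` F); split=> //; first exact: closed_openC.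
  apply: (@le_lt_trans _ _ 0%E); last by rewrite lte_fin.
  apply: ge_ereal_sup => _ [z [Wz1 Wz2] <-].
  by rewrite !indicE0// !mulr0 subr0 normr0.
Qed.

(** At each point the cutoffs are eventually equal to the indicator of [F]. *)
Lemma cvg_mul_cutoff (R : realType) (Y : topologicalType) (F : set Y)
    (u : nat -> Y -> R) (f_ : nat -> Y -> R) (f : Y -> R) :
  (forall n x, F x -> u n x = 1) ->
  (forall x, ~ F x -> exists U N, [/\ open U, U x &
     forall n y, (N <= n)%N -> U y -> u n y = 0]) ->
  (forall x, f_ ^~ x @ \oo --> f x) ->
  forall x, (fun n => f_ n x * u n x) @ \oo --> f x * \1_F x.
Proof.
move=> u1 u0 ff x; apply: cvgM; first exact: ff.
have [Fx|nFx] := pselect (F x).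
  rewrite indicE1//.
  by under eq_fun do rewrite u1//; exact: cvg_cst.
rewrite indicE0//; have [U [N [oU Ux uN]]] := u0 _ nFx.
apply: cvg_near_cst; exists N => // n /= Nn; exact: uN.
Qed.

Lemma BaireClassM (R : realType) (Y : topologicalType) (xi : Ord)
    (f u : Y -> R) :
  continuous u -> BaireClass xi f -> BaireClass xi (fun x => f x * u x).
Proof.
move=> cu; elim=> [zeta g z0 cg|zeta g g_ xi_ xi_lt _ IH gg].
  apply: BaireClass_continuous => // x; apply: cvgM; [exact: cg|exact: cu].
apply: BaireClass_limit xi_lt IH _ => x.
by apply: cvgM; [exact: gg|exact: cvg_cst].
Qed.

(** For [xi >= 1] the function is a limit of functions of lower class; multiplying the [n]-th one by
    the [n]-th continuous cutoff keeps its class. *)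
Lemma BaireClass_indic (R : realType) (Y : topologicalType) (xi : Ord)
    (f : Y -> R) (F : set Y) :
  polish R Y -> closed F -> ole oone xi -> BaireClass xi f ->
  BaireClass xi (fun x => f x * \1_F x).
Proof.
move=> pY cF xi1; have [u [cu u1 u0]] := polish_cutoff pY cF.
move=> Bf; case: Bf xi1 => [zeta g z0 _|zeta g g_ xi_ xi_lt Bg gg] xi1.
  by have := ole_trans xi1 z0.
apply: BaireClass_limit xi_lt (fun n => BaireClassM (cu n) (Bg n)) _.
exact: cvg_mul_cutoff.
Qed.

Lemma BaireClass0_continuous (R : realType) (Y : topologicalType) (xi : Ord)
    (f : Y -> R) : ole xi ozero -> BaireClass xi f -> continuous f.
Proof.
move=> xi0 Bf; case: Bf xi0 => [//|zeta g g_ xi_ lt _ _] xi0.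
by have := ole_trans (lt 0%N) xi0.
Qed.

Lemma BaireClass1_limit (R : realType) (Y : topologicalType) (f : Y -> R) :
  BaireClass oone f -> exists f_ : nat -> Y -> R,
    (forall n, continuous (f_ n)) /\ (forall x, f_ ^~ x @ \oo --> f x).
Proof.
move E : oone => xi Bf; case: Bf E => [zeta g z0 _ E|zeta g g_ xi_ lt Bg gg E].
  by move: z0; rewrite -E.
exists g_; split=> // n; apply: BaireClass0_continuous (Bg n).
by have := lt n; rewrite -E.
Qed.

Lemma gamma_rank_indic (R : realType) (Y : topologicalType) (f : Y -> R)
    (F : set Y) :
  polish R Y -> closed F -> BaireClass oone f ->
  ole (gamma_rank (fun x => f x * \1_F x)) (oadd oone (gamma_rank f)).
Proof.
move=> pY cF /BaireClass1_limit[g_ [cg gf]].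
have [u [cu u1 u0]] := polish_cutoff pY cF.
rewrite [gamma_rank f]/gamma_rank; set S := [set r | _].
(* Being of class 1 provides a sequence of continuous approximations, so the minimum defining the
   rank of [f] is attained, by [f_] below. *)
have S0 : S !=set0.
  by exists (osup (fun e : {e : R | 0 < e} => rk (Dconv g_ (sval e)))), g_.
have [f_ [cf ff ->]] := omin_mem S0.
pose h_ n x := f_ n x * u n x.
apply: (@ole_trans (osup (fun e : {e : R | 0 < e} => rk (Dconv h_ (sval e))))).
  apply: omin_le; exists h_; split=> // [n x|].
    by apply: cvgM; [exact: cf|exact: cu].
  exact: cvg_mul_cutoff.
apply: osup_shift => -[e /= e0]; rewrite !Dconv_Dloc.
apply: (@rk_Dloc_shift _ _ _ _ _ F) => //; try exact: cauchy_diam_homo.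
- move=> W WF; congr ereal_inf; apply: eq_imagel => N _; congr ereal_sup.
  apply/seteqP; split=> _ [n [m [y [Nn Nm Wy ->]]]]; exists n, m, y; split=> //.
    by rewrite /h_ !u1 ?mulr1//; exact: WF.
  by rewrite /h_ !u1 ?mulr1//; exact: WF.
(* On [U] the functions [h_ n] with [n >= N] vanish, so the tail from [N] bounds the infimum by
   0. *)
- move=> x /u0[U [N [oU Ux uN]]]; exists U; split=> //.
  apply: (@le_lt_trans _ _ 0%E); last by rewrite lte_fin.
  apply: (@le_trans _ _ (ereal_sup [set v | exists n m y, [/\ (N <= n)%N,
      (N <= m)%N, U y & v = (`|h_ m y - h_ n y|)%:E]])).
    by apply: ereal_inf_lbound; exists N.
  apply: ge_ereal_sup => _ [n [m [y [Nn Nm Uy ->]]]].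
  by rewrite /h_ !uN// !mulr0 subr0 normr0.
Qed.

(** * Passage to the minimum over finer topologies *)

(** A topology attaining the minimum for [f] competes in the minimum for [g]. If [f] has no
    admissible topology, its value is [omega1] by convention, and the last hypothesis bounds the
    value for [g]. *)
Lemma star_shift (R : realType) (X : topologicalType)
    (rho : forall Y : topologicalType, (Y -> R) -> Ord) (xi : Ord)
    (f g : X -> R) :
  Tset f xi `<=` Tset g xi ->
  (forall t, Tset f xi t ->
    ole (rho (retop t) g) (oadd oone (rho (retop t) f))) ->
  (forall t, Tset g xi t -> ole (rho (retop t) g) omega1) ->
  ole (star rho xi g) (oadd oone (star rho xi f)).
Proof.
move=> fg rfg rg.
have [S0|nS] := pselect
    ([set r | exists2 t, Tset f xi t & r = rho (retop t) f] !=set0).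
  rewrite [star rho xi f]/star; have [t Tt ->] := omin_mem S0.
  apply: ole_trans (rfg t Tt); apply: omin_le; exists t => //; exact: fg.
rewrite [star rho xi f]/star (ominNex nS).
apply: (@ole_trans omega1); last exact: oadd_ler.
have [S0|nS'] := pselect
    ([set r | exists2 t, Tset g xi t & r = rho (retop t) g] !=set0).
  by rewrite /star; have [t Tt ->] := omin_mem S0; exact: rg.
by rewrite /star (ominNex nS'); exact: olexx.
Qed.

Theorem theorem5p10 (R : realType) (X : topologicalType)
    (polishX : polish R X) (uncountableX : ~ countable [set: X])
    (xi : Ord) (xi_ge1 : ole oone xi) (xi_lt_omega1 : olt xi omega1)
    (f : X -> R) (Bf : BaireClass xi f) (F : set X) (closedF : closed F) :
  let fF := (fun x : X => f x * \1_F x) in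
  [/\ BaireClass xi fF,
      ole (star (@alpha_rank R) xi fF) (oadd oone (star (@alpha_rank R) xi f)),
      ole (star (@beta_rank R) xi fF) (oadd oone (star (@beta_rank R) xi f)) &
      ole (star (@gamma_rank R) xi fF) (oadd oone (star (@gamma_rank R) xi f))].
Proof.
move=> fF.
have closedFt t : @open X `<=` topo_open t -> @closed (retop t) F.
  move=> Xt; rewrite -openC; apply: Xt; exact: closed_openC.
have TT : Tset f xi `<=` Tset fF xi.
  move=> t [pt Xt tX Bt]; split=> //.
  (* Here the product lemma is used at class 1 in the finer topology, not at class [xi]. *)
  apply: (@BaireClass_indic R (retop t)) => //; exact: closedFt.
split; first exact: BaireClass_indic.
- apply: star_shift => // t [pt Xt _ _].
    by apply: (@alpha_rank_indic R (retop t)) => //; exact: closedFt.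
  exact: alpha_rank_le.
- apply: star_shift => // t [pt Xt _ _].
    by apply: (@beta_rank_indic R (retop t)) => //; exact: closedFt.
  exact: beta_rank_le.
- apply: star_shift => // t [pt Xt _ Bt].
    by apply: (@gamma_rank_indic R (retop t)) => //; exact: closedFt.
  exact: gamma_rank_le.
Qed.
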